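(* Let $R$ be an $F$-restriction semigroup. Then: (1) $R$ is proper; (2) $R$ has a maximum projection, denoted by $\lambda$, and it is the unique left identity in $R$.
   Context: A restriction semigroup is an algebra $(R;\cdot,{}^+)$ of type $(2,1)$ such that $(R;\cdot)$ is a semigroup and the identities $x^+x=x$, $x^+y^+=y^+x^+$, $(x^+y)^+=x^+y^+$, $xy^+=(xy)^+x$ hold. Its set of projections is $P(R)=\{s^+ : s\in R\}$. The natural partial order is $s\le t$ iff $s=et$ for some $e\in P(R)$ (equivalently $s=s^+t$). The congruence $\sigma$ is the minimum congruence identifying all projections: $s\mathrel{\sigma}t$ iff $es=et$ for some $e\in P(R)$. A restriction semigroup is proper if $s^+=t^+$ and $s\mathrel{\sigma}t$ imply $s=t$. It is $F$-restriction if every $\sigma$-class contains a maximum element with respect to $\le$. *)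

(* Defs.v *)
From HB Require Import structures.
From mathcomp Require Import all_boot.
From Corelib Require Import RelationClasses.

Set Implicit Arguments.
Unset Strict Implicit.
Unset Printing Implicit Defensive.

Local Open Scope group_scope.

(* Built on magmaType rather than semigroupType: MathComp's semigroups carry a
   choiceType structure (in particular decidable equality), which is not part
   of the algebraic notion. As usual for algebras, the carrier is nonempty.
   The unary operation x^+ is written [rplus x]. *)
HB.mixin Record Magma_isRestriction R of Magma R := {
  restr_inhabited : inhabited R;
  restr_mulA : associative (@mul R);
  rplus : R -> R;
  rplus_mul : forall x : R, rplus x * x = x;
  rplusC : forall x y : R, rplus x * rplus y = rplus y * rplus x;
  rplusM : forall x y : R, rplus (rplus x * y) = rplus x * rplus y;
  mul_rplus : forall x y : R, x * rplus y = rplus (x * y) * x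
}.

#[short(type="restrictionType")]
HB.structure Definition Restriction := {R of Magma_isRestriction R & Magma R}.

Section Definitions.

Variable R : restrictionType.
Implicit Types (s t e f l m : R) (r : R -> R -> Prop) (A : R -> Prop).

Definition projection e : Prop := exists s, e = rplus s.

Definition natle s t : Prop := exists2 e, projection e & s = e * t.

Definition congruence r : Prop :=
  [/\ Equivalence r,
      forall s t s' t', r s t -> r s' t' -> r (s * s') (t * t')
    & forall s t, r s t -> r (rplus s) (rplus t)].

Definition identifies_projections r : Prop :=
  forall e f, projection e -> projection f -> r e f.

(* The intersection of all congruences identifying the projections; see
   [sigma_congruence], [sigma_proj] and [sigma_min] for minimality, and
   [sigmaP] for the first-order description. *)
Definition sigma s t : Prop :=
  forall r, congruence r -> identifies_projections r -> r s t.

Definition maximum A m : Prop := A m /\ forall s, A s -> natle s m.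

Definition left_identity l : Prop := left_id l (@mul R).

End Definitions.

Definition proper_restriction (R : restrictionType) : Prop :=
  forall s t : R, rplus s = rplus t -> sigma s t -> s = t.

Definition F_restriction (R : restrictionType) : Prop :=
  forall s : R, exists m : R, maximum (sigma s) m.

Section Facts.

Variable R : restrictionType.
Implicit Types (s t u e f : R) (r : R -> R -> Prop).

Lemma rplusK s : rplus (rplus s) = rplus s.
Proof.
have idem : rplus s * rplus s = rplus s by rewrite -rplusM rplus_mul.
by rewrite -{2}(rplus_mul (rplus s)) rplusC -rplusM idem.
Qed.

Lemma rplus_proj e : projection e -> rplus e = e.
Proof. by case=> s ->; rewrite rplusK. Qed.

Lemma proj_rplus s : projection (rplus s). Proof. by exists s. Qed.

Lemma projM e f : projection e -> projection f -> projection (e * f).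
Proof. by move=> [s ->] [t ->]; exists (rplus s * t); rewrite rplusM. Qed.

Lemma projC e f : projection e -> projection f -> e * f = f * e.
Proof. by move=> [s ->] [t ->]; rewrite rplusC. Qed.

Lemma proj_idem e : projection e -> e * e = e.
Proof. by case=> s ->; rewrite -rplusM rplus_mul. Qed.

Lemma natleP s t : natle s t <-> s = rplus s * t.
Proof.
split=> [[e [x ->] ->]|->]; last by exists (rplus s) => //; exact: proj_rplus.
rewrite rplusM -restr_mulA rplus_mul //.
Qed.

Lemma natle_refl s : natle s s.
Proof. by apply/natleP; rewrite rplus_mul. Qed.

Lemma natle_trans t s u : natle s t -> natle t u -> natle s u.
Proof.
by move=> [e he ->] [f hf ->]; exists (e * f); [exact: projM | rewrite restr_mulA].
Qed.

Lemma natle_antisym s t : natle s t -> natle t s -> s = t.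
Proof.
move=> [e he hs] [f hf ht].
have es : e * s = s by rewrite hs restr_mulA proj_idem.
by rewrite ht -{2}es restr_mulA (projC hf he) -restr_mulA -ht -hs.
Qed.

Let sig s t := exists2 e, projection e & e * s = e * t.

Let sig_congruence : congruence sig.
Proof.
split; [split|..].
- by move=> s; exists (rplus s) => //; exact: proj_rplus.
- by move=> s t [e he h]; exists e.
- move=> s t u [e he hs] [f hf ht]; exists (f * e); first exact: projM.
  by rewrite -restr_mulA hs restr_mulA (projC hf he) -!restr_mulA ht.
- move=> s t s' t' [e he hs] [f [x def_f] hf].
  have hg: projection (rplus (t * f)) by exact: proj_rplus.
  exists (e * rplus (t * f)); first exact: projM.
  have absorb y : rplus (t * f) * (t * y) = t * (f * y).
    by rewrite !restr_mulA def_f -mul_rplus rplusK.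
  rewrite (projC he hg) -!restr_mulA (restr_mulA e s) hs -(restr_mulA e t).
  by rewrite !(restr_mulA _ e) -(projC he hg) -!restr_mulA !absorb hf.
- move=> s t [e [x ->] h]; exists (rplus x); first exact: proj_rplus.
  by rewrite -!rplusM h.
Qed.

Let sig_proj : identifies_projections sig.
Proof.
move=> e f he hf; exists (e * f); first exact: projM.
by rewrite -[RHS]restr_mulA (proj_idem hf) (projC he hf) -restr_mulA (proj_idem he).
Qed.

Lemma sigmaP s t : sigma s t <-> exists2 e, projection e & e * s = e * t.
Proof.
split=> [st|[e he h] r [[rr rs rt] rM _] rP].
  exact: (st sig sig_congruence sig_proj).
apply: (rt _ (e * s)).
  by rewrite -{1}(rplus_mul s); apply: rM => //; apply: rP => //; exact: proj_rplus.
by rewrite h -{2}(rplus_mul t); apply: rM => //; apply: rP => //; exact: proj_rplus.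
Qed.

Lemma sigma_min r :
  congruence r -> identifies_projections r -> forall s t, sigma s t -> r s t.
Proof. by move=> rC rP s t; apply. Qed.

Lemma sigma_congruence : congruence (@sigma R).
Proof.
case: sig_congruence => -[rr rs rt] rM rp; split; [split|..].
- by move=> s; apply/sigmaP/rr.
- by move=> s t /sigmaP/rs/sigmaP.
- by move=> s t u /sigmaP h /sigmaP h'; apply/sigmaP/(rt _ _ _ h h').
- by move=> s t s' t' /sigmaP h /sigmaP h'; apply/sigmaP/(rM _ _ _ _ h h').
- by move=> s t /sigmaP/rp/sigmaP.
Qed.

Lemma sigma_proj : identifies_projections (@sigma R).
Proof. by move=> e f he hf r _; apply. Qed.

End Facts.

(* Main.v *)
Require Import Defs.
From mathcomp Require Import all_boot.

(** An element s below m is recovered from its projection, as s = s^+ m. If the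
    sigma-class of s and t has a maximum m and s^+ = t^+, this gives
    s = s^+ m = t^+ m = t, which is properness.

    All projections lie in one sigma-class; let m be its maximum. Since m^+ is
    itself below m, the same formula gives m^+ = m^+ m = m, so m is a
    projection, hence the largest one ([F_restriction_max_projection]). A
    maximum projection fixes every x^+ on the left, hence also x = x^+ x.
    Uniqueness holds because a left identity is always a projection
    ([left_identity_projection]): it lies below the maximum projection, and
    multiplies it trivially. *)

Lemma F_restriction_proper (R : restrictionType) :
  F_restriction R -> proper_restriction R.
Proof.
move=> hF s t st sig_st; have [m [_ m_max]] := hF s.
have /natleP -> := m_max _ sig_st.
have [[sig_refl _ _] _ _] := sigma_congruence R.
by have /natleP {1}-> := m_max _ (sig_refl s); rewrite st.
Qed.

Lemma F_restriction_max_projection (R : restrictionType) :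
  F_restriction R -> exists m : R, maximum (@projection R) m.
Proof.
move=> hF; have [x] := restr_inhabited (s := R).
have [m [_ m_max]] := hF (rplus x).
have ub e : projection e -> natle e m.
  by move=> he; apply: m_max; apply: sigma_proj => //; exact: proj_rplus.
exists m; split=> //; exists m.
have /natleP := ub _ (proj_rplus m).
by rewrite rplusK rplus_mul.
Qed.

Lemma max_projection_left_identity (R : restrictionType) (m : R) :
  maximum (@projection R) m -> left_identity m.
Proof.
move=> [m_proj m_max] x.
have /natleP := m_max _ (proj_rplus x); rewrite rplusK => xm.
by rewrite -{1}(rplus_mul x) restr_mulA (projC m_proj (proj_rplus x)) -xm rplus_mul.
Qed.

(** The two sides of l l^+ = (l l)^+ l reduce to l^+ and to l^+ l = l. *)
Lemma left_identity_projection (R : restrictionType) (l : R) :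
  left_identity l -> projection l.
Proof. by move=> hl; exists l; rewrite -[RHS]hl mul_rplus hl rplus_mul. Qed.

Theorem proposition3p2 (R : restrictionType) (hF : F_restriction R) :
  proper_restriction R /\
  exists lambda : R,
    [/\ maximum (@projection R) lambda,
        left_identity lambda
      & forall l : R, left_identity l -> l = lambda].
Proof.
split; first exact: F_restriction_proper.
have [m m_max] := F_restriction_max_projection _ hF.
exists m; split=> //; first exact: max_projection_left_identity.
move=> l hl; have l_proj := left_identity_projection _ _ hl.
have /natleP := m_max.2 _ l_proj.
by rewrite (rplus_proj l_proj) hl.
Qed.
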